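(* Let $C=(c_{rs})$ be a real symmetric circulant $n\times n$ matrix, and let $\epsilon\in\mathbb{R}$. For $0\le j\le n-1$ let $$\theta^{(j)}=\left(0,\frac{2\pi j}{n},\dots,\frac{2\pi j(n-1)}{n}\right)^T.$$ Then for each $0\le j\le n-1$: (1) $\theta^{(j)}$ is an equilibrium point of the complex-valued Kuramoto model with adjacency matrix $C$ and coupling strength $\epsilon$; (2) $\theta^{(j)}$ is an equilibrium point of the original Kuramoto model with adjacency matrix $C$.
   Context: Here $\mathbf{i}=\sqrt{-1}$, and exponentials and arguments of vectors are taken entrywise. Let $A=(a_{ij})$ be a real $N\times N$ matrix (the weighted adjacency matrix). Original Kuramoto model (zero natural frequencies): $\frac{d\theta_i}{dt}=\epsilon\sum_{j=1}^N a_{ij}\sin(\theta_j-\theta_i)$, $1\le i\le N$. A point $\theta_0=(\theta_1,\dots,\theta_N)\in\mathbb{R}^N$ is an equilibrium point of it if $\sum_{j=1}^N a_{ij}\sin(\theta_j-\theta_i)=0$ for all $1\le i\le N$. Complex-valued Kuramoto model: $\frac{d\theta_i}{dt}=\epsilon\sum_{j=1}^N a_{ij}\left[\sin(\theta_j-\theta_i)-\mathbf{i}\cos(\theta_j-\theta_i)\right]$ with $\theta_i\in\mathbb{C}$; under $x=e^{\mathbf{i}\theta}$ it becomes $\frac{dx}{dt}=\epsilon Ax$, with solution $x(t)=e^{\epsilon tA}x(0)$. A real vector $\theta_0$ is an equilibrium point of it if, with $x_0=e^{\mathbf{i}\theta_0}$, for all $t\ge0$ one has $\arg(e^{\epsilon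 tA}x_0)=\arg(x_0)=\theta_0$, arguments being understood modulo $2\pi$ (in particular every entry of $e^{\epsilon tA}x_0$ is nonzero). *)

(* Defs.v *)
From mathcomp Require Import all_boot all_order all_algebra.
From mathcomp Require Import all_classical all_reals all_analysis.
From mathcomp Require Import complex.
Set Implicit Arguments.
Unset Strict Implicit.
Unset Printing Implicit Defensive.
Import Order.TTheory GRing.Theory Num.Theory numFieldNormedType.Exports.
Local Open Scope classical_set_scope.
Local Open Scope complex_scope.
Local Open Scope ring_scope.

(* The entry at (r, s) depends only on s - r modulo n; "s + n - r" avoids a
   truncated subtraction, since r < n. *)
Definition is_circulant (R : realType) (n : nat) (C : 'M[R]_n) : Prop :=
  exists c : nat -> R, forall r s : 'I_n, C r s = c ((s + n - r) %% n)%N.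

Definition mxexp (R : realType) (n : nat) (A : 'M[R]_n) : 'M[R]_n :=
  limn (series (fun k => (k`!%:R)^-1 *: A ^+ k)).

Definition expi (R : realType) (a : R) : R[i] := cos a +i* sin a.

(* The set of all real arguments of z, that is, "arg z modulo 2 pi"; it is empty
   when z = 0. *)
Definition args (R : realType) (z : R[i]) : set R :=
  [set a | z != 0 /\ z = `|z| * expi a].

Definition kuramoto_equilibrium (R : realType) (N : nat)
    (A : 'M[R]_N) (theta : 'cV[R]_N) : Prop :=
  forall i : 'I_N, \sum_(j < N) A i j * sin (theta j 0 - theta i 0) = 0.

(* Value at time t of the solution of dx/dt = eps A x with x(0) = x0. *)
Definition complex_kuramoto_flow (R : realType) (N : nat) (A : 'M[R]_N)
    (eps t : R) (x0 : 'cV[R[i]]_N) : 'cV[R[i]]_N :=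
  map_mx (real_complex R) (mxexp ((eps * t) *: A)) *m x0.

(* "arg (x t) = arg x0 = theta" modulo 2 pi, entrywise and for all t >= 0; the
   entries of x t are nonzero because their argument sets are inhabited. *)
Definition complex_kuramoto_equilibrium (R : realType) (N : nat)
    (A : 'M[R]_N) (eps : R) (theta : 'cV[R]_N) : Prop :=
  let x0 := map_mx (@expi R) theta in
  forall t : R, 0 <= t -> forall i : 'I_N,
    args (complex_kuramoto_flow A eps t x0 i 0) = args (x0 i 0) /\
    args (x0 i 0) (theta i 0).

Definition twisted_state (R : realType) (n j : nat) : 'cV[R]_n :=
  \col_(k < n) (2 * pi * j%:R * k%:R / n%:R).

(* Main.v *)
Require Import Defs.
From mathcomp Require Import all_boot all_order all_algebra.
From mathcomp Require Import all_classical all_reals all_analysis.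
From mathcomp Require Import complex ring.
Set Implicit Arguments.
Unset Strict Implicit.
Import Order.TTheory GRing.Theory Num.Theory numFieldNormedType.Exports.
Local Open Scope classical_set_scope.
Local Open Scope ring_scope.

(** Put [u k = cos (theta k)] and [w k = sin (theta k)].  Circulance makes
    [lambda = \sum_s C i s * cos (theta s - theta i)] and
    [sigma = \sum_s C i s * sin (theta s - theta i)] independent of [i], and
    symmetry gives [sigma = - sigma = 0].  By the addition formulas [u] and [w]
    are then real eigenvectors of [C] for the same real eigenvalue [lambda], so
    the flow multiplies [exp (i theta)] by the positive real
    [exp (eps * t * lambda)] and leaves all arguments unchanged. *)

(** There are only finitely many entries, so their eventual bounds hold simultaneously. *)
Lemma cvg_mxP (R : realType) (m n : nat) (u : nat -> 'M[R]_(m, n))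
    (M : 'M[R]_(m, n)) :
  (forall i j, (fun k => u k i j) @ \oo --> M i j) -> u @ \oo --> M.
Proof.
move=> uM; apply/cvg_ballP => e e0.
have : \forall k \near \oo, forall i j, ball (M i j) e (u k i j).
  apply: filter_forall => i; apply: filter_forall => j.
  by move/cvg_ballP: (uM i j); exact.
by apply: filterS => k Mk; split.
Qed.

(** The total of all [|A p q|] dominates every absolute row sum, so each further factor [A] costs at
    most one factor of it. The bound is crude but geometric, which suffices to compare with a scalar
    exponential series. *)
Lemma normr_exp_mx_le (R : realType) (n : nat) (A : 'M[R]_n) (k : nat)
    (i j : 'I_n) :
  `|(A ^+ k) i j| <= (\sum_p \sum_q `|A p q|) ^+ k.
Proof.
elim: k i j => [|k IH] i j.
  by rewrite !expr0 mxE; case: (i == j); rewrite ?normr1 ?normr0 ?ler01.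
set b := \sum_p _ in IH *.
have b0 : 0 <= b by apply: sumr_ge0 => p _; exact: sumr_ge0.
rewrite !exprS mxE; apply: (le_trans (ler_norm_sum _ _ _)).
apply: (@le_trans _ _ (\sum_q `|A i q| * b ^+ k)).
  by apply: ler_sum => q _; rewrite normrM ler_wpM2l.
rewrite -mulr_suml ler_wpM2r ?exprn_ge0// /b [leRHS](bigD1 i)//= lerDl.
by apply: sumr_ge0 => p _; exact: sumr_ge0.
Qed.

(** [limn] means something only once a limit exists. Each entry of the series converges absolutely,
    by comparison with a real exponential series. *)
Lemma cvg_mxexp (R : realType) (n : nat) (A : 'M[R]_n) :
  series (fun k => (k`!%:R)^-1 *: A ^+ k) @ \oo --> mxexp A.
Proof.
suff: exists M : 'M[R]_n, series (fun k => (k`!%:R)^-1 *: A ^+ k) @ \oo --> M.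
  by move=> [M AM]; apply/cvg_ex; exists M.
exists (\matrix_(i, j) limn (series (fun k => (k`!%:R)^-1 * (A ^+ k) i j))).
apply: cvg_mxP => i j; rewrite mxE.
have -> : (fun k => series (fun l => (l`!%:R)^-1 *: A ^+ l) k i j) =
    series (fun k => (k`!%:R)^-1 * (A ^+ k) i j).
  apply/funext => k; rewrite /series /= summxE.
  by apply: eq_bigr => l _; rewrite mxE.
apply: normed_cvg.
apply: (@series_le_cvg _ _ (exp_coeff (\sum_p \sum_q `|A p q|))) => [k|k|k|].
- exact: normr_ge0.
- by apply: exp_coeff_ge0; apply: sumr_ge0 => p _; exact: sumr_ge0.
- rewrite exp_coeffE /= normrM ger0_norm ?invr_ge0 ?ler0n//.
  by rewrite ler_wpM2l ?invr_ge0 ?ler0n// normr_exp_mx_le.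
- exact: is_cvg_series_exp_coeff.
Qed.

Lemma exp_mx_eigenvector (R : comPzRingType) (n : nat) (A : 'M[R]_n)
    (v : 'cV[R]_n) (a : R) (k : nat) :
  A *m v = a *: v -> (A ^+ k) *m v = a ^+ k *: v.
Proof.
move=> Av; elim: k => [|k IH]; first by rewrite !expr0 mul1mx scale1r.
by rewrite exprSr [A ^+ k * A]/(A ^+ k *m A) -mulmxA Av -scalemxAr IH scalerA
  exprS.
Qed.

(** Each entry of the partial sums applied to [v] tends to both sides, and limits are unique. *)
Lemma mxexp_eigenvector (R : realType) (n : nat) (A : 'M[R]_n)
    (v : 'cV[R]_n) (a : R) :
  A *m v = a *: v -> mxexp A *m v = expR a *: v.
Proof.
move=> Av; apply/colP => i.
set S := series (fun k => (k`!%:R)^-1 *: A ^+ k).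
have SvE k : (S k *m v) i 0 = series (exp_coeff a) k * v i 0.
  rewrite /S /series /= mulmx_suml summxE mulr_suml.
  apply: eq_bigr => l _.
  by rewrite -scalemxAl (exp_mx_eigenvector l Av) exp_coeffE !mxE mulrA.
have lim1 : (fun k => (S k *m v) i 0) @ \oo --> (mxexp A *m v) i 0.
  rewrite mxE; under eq_fun do rewrite mxE.
  apply: cvg_big => [|q _]; first exact: add_continuous.
  apply: cvgMl.
  apply: (@cvg_comp _ _ _ S (fun M : 'M[R]_n => M i q) _ (nbhs (mxexp A))).
    exact: cvg_mxexp.
  exact: coord_continuous.
have lim2 : (fun k => (S k *m v) i 0) @ \oo --> (expR a *: v) i 0.
  rewrite mxE; under eq_fun do rewrite SvE.
  by apply: cvgMl; exact: is_cvg_series_exp_coeff.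
exact: (cvg_unique (@norm_hausdorff _ _) lim1 lim2).
Qed.

Lemma sum_ord_rotate (V : nmodType) (n : nat) (i : 'I_n) (g : nat -> V) :
  \sum_(s < n) g ((s + n - i) %% n)%N = \sum_(d < n) g d.
Proof.
case: n i => [[]//|n] i.
(* Ordinals below a successor form a cyclic group, where translation by [- i] is a bijection. *)
rewrite [RHS](reindex_inj (addIr (- i))); apply: eq_bigr => s _ /=.
by rewrite modnDmr addnBA// ltnW.
Qed.

Lemma sum_ord_reflect (V : nmodType) (n : nat) (g : nat -> V) :
  \sum_(d < n) g ((n - d) %% n)%N = \sum_(d < n) g d.
Proof. by case: n => [|n]; rewrite ?big_ord0// [RHS](reindex_inj oppr_inj). Qed.

Section TwistedAngle.
Variables (R : realType) (n j : nat).
Hypothesis n_gt0 : (0 < n)%N.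

Let angle (k : nat) : R := 2 * pi * j%:R * k%:R / n%:R.

Let n_neq0 : n%:R != 0 :> R.
Proof. by rewrite pnatr_eq0 -lt0n. Qed.

(** Each block of [n] indices adds [2 * pi * j] to the angle, that is [j] full periods. *)
Lemma twisted_angle_mod (f : R -> R) (k : nat) :
  periodic f (pi *+ 2) -> f (angle (k %% n)) = f (angle k).
Proof.
move=> fP; rewrite [in RHS](divn_eq k n) -(periodicn fP (j * (k %/ n))).
by congr f; rewrite /angle -mulr_natr !natrD !natrM -mulr_natr; field.
Qed.

Lemma twisted_angleB (f : R -> R) (s i : nat) : (i <= n)%N ->
  periodic f (pi *+ 2) ->
  f (angle s - angle i) = f (angle ((s + n - i) %% n)).
Proof.
move=> lein fP; rewrite twisted_angle_mod// -(periodicn fP j); congr f.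
rewrite /angle -addnBA// natrD natrB// -mulr_natr -[pi *+ 2]mulr_natr.
by field.
Qed.

Lemma circulant_sum_angleB (C : 'M[R]_n) (c : nat -> R) (f : R -> R)
    (i : 'I_n) : (forall r s : 'I_n, C r s = c ((s + n - r) %% n)%N) ->
  periodic f (pi *+ 2) ->
  \sum_(s < n) C i s * f (angle s - angle i) = \sum_(d < n) c d * f (angle d).
Proof.
move=> CE fP; rewrite -(sum_ord_rotate i (fun d => c d * f (angle d))).
by apply: eq_bigr => s _; rewrite CE twisted_angleB// ltnW.
Qed.

(** Symmetry makes [c] even modulo [n] while sine is odd, so reflecting the index negates the
    sum. *)
Lemma symmetric_circulant_sum_sin (C : 'M[R]_n) (c : nat -> R) :
  C^T = C -> (forall r s : 'I_n, C r s = c ((s + n - r) %% n)%N) ->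
  \sum_(d < n) c d * sin (angle d) = 0.
Proof.
move=> CT CE; set S := \sum_(d < n) _.
have cN (d : 'I_n) : c ((n - d) %% n)%N = c d.
  (* Compare row 0 with column 0 of [C]. *)
  have := CE (Ordinal n_gt0) d; rewrite -[in LHS]CT mxE CE /= add0n subn0.
  by rewrite modnDr (modn_small (ltn_ord d)).
have SN : S = - S.
  rewrite {1}/S -(sum_ord_reflect n (fun d => c d * sin (angle d))) -sumrN.
  apply: eq_bigr => d _; rewrite cN -mulrN -sinN twisted_angle_mod//.
    (* The angle of [n - d] is [- angle d] plus [j] full periods. *)
    rewrite -(periodicn (@sinD2pi R) j (- angle d)); congr (_ * sin _).
    rewrite /angle natrB; last exact: ltnW.
    by rewrite -[_ *+ j]mulr_natr -[pi *+ 2]mulr_natr; field.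
  exact: sinD2pi.
by apply/eqP; rewrite -eqNr -SN.
Qed.

End TwistedAngle.

Lemma sum_complex (R : rcfType) (I : finType) (a b : I -> R) :
  \sum_s (a s +i* b s)%C = ((\sum_s a s) +i* (\sum_s b s))%C.
Proof. by elim/big_rec3: _ => // s x y z _ ->; simpc. Qed.

(** A positive factor multiplies [z] and its modulus alike, so it cancels from the defining
    equation. *)
Lemma args_mul_pos (R : realType) (r : R) (z : R[i]) : 0 < r ->
  args (real_complex R r * z) = args z.
Proof.
move=> r0; have r0C : real_complex R r != 0.
  by rewrite fmorph_eq0 gt_eqF.
have normrC : `|real_complex R r| = real_complex R r.
  by apply: ger0_norm; rewrite ler0c ltW.
apply/seteqP; split => a [z0 zE]; split.
- by move: z0; rewrite mulf_eq0 negb_or => /andP[].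
- by apply: (mulfI r0C); rewrite zE normrM normrC mulrA.
- by rewrite mulf_neq0.
- by rewrite normrM normrC {1}zE mulrA.
Qed.

Lemma args_expi (R : realType) (a : R) : args (expi a) a.
Proof.
have nE : `|expi a| = 1.
  by rewrite normc_def /= cos2Dsin2 sqrtr1.
by split; rewrite ?nE ?mul1r// -normr_gt0 nE.
Qed.

Theorem proposition3 (R : realType) (n : nat) (C : 'M[R]_n) (eps : R)
  (hsym : C^T = C) (hcirc : is_circulant C) (j : nat) (hj : (j < n)%N) :
  complex_kuramoto_equilibrium C eps (twisted_state R n j) /\
  kuramoto_equilibrium C (twisted_state R n j).
Proof.
have n_gt0 : (0 < n)%N by exact: leq_ltn_trans hj.
have [c CE] := hcirc.
set th := twisted_state R n j.
have thE k : th k 0 = 2 * pi * j%:R * k%:R / n%:R by rewrite mxE.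
have sin_eq0 i : \sum_(s < n) C i s * sin (th s 0 - th i 0) = 0.
  under eq_bigr do rewrite !thE.
  rewrite (circulant_sum_angleB j n_gt0 i CE); last exact: sinD2pi.
  exact: (symmetric_circulant_sum_sin j n_gt0 hsym CE).
split=> //.
pose lam := \sum_(d < n) c d * cos (2 * pi * j%:R * d%:R / n%:R : R).
have cosE i : \sum_(s < n) C i s * cos (th s 0 - th i 0) = lam.
  under eq_bigr do rewrite !thE.
  by rewrite (circulant_sum_angleB j n_gt0 i CE)//; exact: cosD2pi.
have Ccos : C *m map_mx cos th = lam *: map_mx cos th.
  apply/colP => i; rewrite !mxE -!thE.
  (* Writing [th s] as [(th s - th i) + th i] in the addition formula pulls the factors in [th i]
     out of the sum over [s]. *)
  transitivity ((\sum_s C i s * cos (th s 0 - th i 0)) * cos (th i 0) -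
                (\sum_s C i s * sin (th s 0 - th i 0)) * sin (th i 0)); last first.
    by rewrite cosE sin_eq0 mul0r subr0.
  rewrite !mulr_suml -sumrB.
  apply: eq_bigr => s _; rewrite [map_mx _ _ _ _]mxE.
  by rewrite -[in LHS](subrK (th i 0) (th s 0)) [in LHS]cosD; ring.
have Csin : C *m map_mx sin th = lam *: map_mx sin th.
  apply/colP => i; rewrite !mxE -!thE.
  transitivity ((\sum_s C i s * cos (th s 0 - th i 0)) * sin (th i 0) +
                (\sum_s C i s * sin (th s 0 - th i 0)) * cos (th i 0)); last first.
    by rewrite cosE sin_eq0 mul0r addr0.
  rewrite !mulr_suml -big_split.
  apply: eq_bigr => s _; rewrite [map_mx _ _ _ _]mxE.
  by rewrite -[in LHS](subrK (th i 0) (th s 0)) [in LHS]sinD /=; ring.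
move=> t _ i; set x0 := map_mx _ th.
have -> : complex_kuramoto_flow C eps t x0 i 0 =
    real_complex R (expR (eps * t * lam)) * x0 i 0.
  set E := mxexp ((eps * t) *: C).
  (* The exponential [E] is real, so it acts separately on the real and imaginary parts of [x0];
     this serves for both [cos] and [sin]. *)
  have flowE (f : R -> R) : C *m map_mx f th = lam *: map_mx f th ->
      \sum_s E i s * f (th s 0) = expR (eps * t * lam) * f (th i 0).
    move=> Cf.
    have /mxexp_eigenvector/colP/(_ i) : (eps * t) *: C *m map_mx f th =
        (eps * t * lam) *: map_mx f th by rewrite -scalemxAl Cf scalerA.
    by rewrite !mxE; under eq_bigr do rewrite mxE.
  rewrite [x0 i 0]mxE /complex_kuramoto_flow -/E.
  transitivity ((\sum_s E i s * cos (th s 0)) +i*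
                (\sum_s E i s * sin (th s 0)))%C.
    rewrite mxE -sum_complex; apply: eq_bigr => s _; rewrite !mxE.
    by rewrite /expi; simpc.
  by rewrite (flowE _ Ccos) (flowE _ Csin) /expi; simpc.
split; first by rewrite args_mul_pos// expR_gt0.
by rewrite mxE; exact: args_expi.
Qed.
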